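(* Given a rational $h>0$, let $P_h\subseteq \mathbb{R}^3$ be the convex hull of $\{(0,0,0),(0,2,0),(2,0,0),(1-\frac{1}{h},1-\frac{1}{h},h)\}$. Consider the problem of maximizing $x_3$ over $x\in C\cap S$ with $C=P_h$ and $S=\mathbb{Z}^3$. The optimal value is $0$ and there is a branch-and-bound algorithm with variable disjunctions which certifies $x_3\le 0$ in $O(1)$ steps. However, any cutting plane proof with variable disjunctions of $x_3\le 0$ has $\Omega(h)$ length. The instances can be created in any dimension $n\ge 3$ by taking the Cartesian product of $P_h$ with the hypercube $[-\frac12,\frac12]^{n-3}$ (with $S=\mathbb{Z}^n$ and the same objective).
   Context: A valid disjunction for a closed set $S\subseteq\mathbb{R}^n$ is a finite union $D=Q_1\cup\dots\cup Q_k$ of closed convex sets with $S\subseteq D$. The family $\mathcal{D}$ of variable disjunctions consists of $D_{i,K}=\{x\in\mathbb{R}^n: x_i\le K\}\cup\{x\in\mathbb{R}^n: x_i\ge K+1\}$, $i\in\{1,\dots,n\}$, $K\in\mathbb{Z}$. A cutting plane for a convex set $C$ derived from $D$ is a halfspace $H$ with $C\cap D\subseteq H$. A cutting plane proof based on $\mathcal{D}$ with respect to $C\cap S$ of length $N$ for an inequality $\langle c,x\rangle\le\gamma$ valid for $C\cap S$ is a sequence of halfspaces $H_1,\dots,H_N$ for which there are $D_1,\dots,D_N\in\mathcal{D}$ such that for each $i=0,\dots,N-1$, $H_{i+1}$ is a cutting plane derived from $D_{i+1}$ applied to $C_i:=C\cap\bigcap_{j=1}^{i}H_j$ (with $C_0=C$),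 and $\langle c,x\rangle\le\gamma$ is valid for all points of $C_N:=C\cap\bigcap_{j=1}^{N}H_j$. Branch-and-bound algorithm based on $\mathcal{D}$ (for $\sup\{\langle c,x\rangle: x\in C\cap S\}$): initialize a list $\mathcal{L}:=\{C\}$ and $LB:=-\infty$. While $\mathcal{L}\ne\emptyset$: choose $N\in\mathcal{L}$ and remove it from $\mathcal{L}$; solve $\bar x\in\arg\max\{\langle c,x\rangle:x\in N\}$; if $N=\emptyset$, continue the loop; if no maximizer exists, report ''EXCEPTION'' and stop. If $\langle c,\bar x\rangle>LB$, check whether $\bar x\in S$: if yes, set $LB:=\langle c,\bar x\rangle$; if no, choose a disjunction $D=Q_1\cup\dots\cup Q_k\in\mathcal{D}$ with $\bar x\notin D\cap N$ and add $Q_1\cap N,\dots,Q_k\cap N$ to $\mathcal{L}$ (if no such disjunction exists, report ''NO DISJUNCTION FOUND'' and stop). At the end, if $LB=-\infty$ report infeasibility; otherwise return the $\bar x\in S$ corresponding to the current $LB$ as optimal. A specific strategy for the choices gives a specific algorithm. By just changing the stopping criterion, such an algorithm can be used to certify validity of an upper bound $\langle c,x\rangle\le\gamma$.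
   Formalization: The optimal value and branch-and-bound claims are stated for h ≠ 1, because for h = 1 the fourth vertex (0,0,1) is an integer point, so the optimal value is 1 and x_3 ≤ 0 is not valid. *)

(* Defs.v *)
From mathcomp Require Import all_boot all_order all_algebra.
From mathcomp Require Import boolp classical_sets reals constructive_ereal.
From mathcomp Require Import convex.

Set Implicit Arguments.
Unset Strict Implicit.
Unset Printing Implicit Defensive.

Import Order.TTheory GRing.Theory Num.Theory.

Local Open Scope classical_set_scope.
Local Open Scope ring_scope.

Section EuclideanSpace.
Context {R : realType} {n : nat}.
Local Notation V := 'rV[R]_n.
Implicit Types (c x : V) (A C S H N : set V) (gamma : R).

Definition dot c x : R := \sum_(i < n) c 0 i * x 0 i.

Definition halfspace c gamma : set V := [set x | dot c x <= gamma].

Definition is_halfspace H : Prop :=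
  exists (c : V) (gamma : R), c != 0 /\ H = halfspace c gamma.

Definition convex_hull A : set V := smallest (@convex_set R V) A.

Definition integer_points : set V :=
  [set x : V | forall i, x 0 i \is a Num.int].

Definition argmax c N : set V :=
  [set x | N x /\ forall y, N y -> dot c y <= dot c x].

Definition optimal_value c A (v : R) : Prop :=
  (exists2 x, A x & dot c x = v) /\ (forall x, A x -> dot c x <= v).

(* A disjunction Q_1 `|` ... `|` Q_k is kept as the list of its pieces, since
   branching needs the pieces and not only their union. *)
Definition disjunction := seq (set V).

Implicit Types (D : disjunction) (DD : set disjunction).

Definition disj_set D : set V := \big[setU/set0]_(Q <- D) Q.

Definition variable_disjunction (i : 'I_n) (K : int) : disjunction :=
  [:: [set x : V | x 0 i <= K%:~R]; [set x : V | (K + 1)%:~R <= x 0 i]].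

Definition variable_disjunctions : set disjunction :=
  [set D | exists i K, D = variable_disjunction i K].

Definition cutting_plane C D H : Prop :=
  is_halfspace H /\ C `&` disj_set D `<=` H.

(* With 0-based indices, [nth setT Hs i] is the cut H_{i+1} and
   [C `&` \bigcap_(j < i) nth setT Hs j] is the relaxation C_i. *)
Definition cutting_plane_proof DD C S c gamma (Hs : seq (set V)) : Prop :=
  let relax i := C `&` \bigcap_(j < i) nth setT Hs j in
  [/\ C `&` S `<=` halfspace c gamma,
      exists Ds : seq disjunction, size Ds = size Hs /\
        forall i, (i < size Hs)%N ->
          DD (nth [::] Ds i) /\
          cutting_plane (relax i) (nth [::] Ds i) (nth setT Hs i) &
      relax (size Hs) `<=` halfspace c gamma].

(* [BBRun L inc] is the state at the head of the while loop: [L] is the list of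
   open nodes and [inc] the feasible point attaining LB (LB = -oo if [None]). *)
Inductive bb_state : Type :=
| BBRun of seq (set V) & option V
| BBException
| BBNoDisjunction.

Definition bb_init C : bb_state := BBRun [:: C] None.

Definition bb_final (s : bb_state) : bool :=
  if s is BBRun (_ :: _) _ then false else true.

Definition LB c (inc : option V) : \bar R :=
  if inc is Some x then (dot c x)%:E else -oo%E.

(* One iteration of the loop; the node [N] may be taken anywhere in the list. *)
Inductive bb_step DD S c : bb_state -> bb_state -> Prop :=
| BBEmpty L1 N L2 inc :
    N = set0 ->
    bb_step DD S c (BBRun (L1 ++ N :: L2) inc) (BBRun (L1 ++ L2) inc)
| BBNoMaximizer L1 N L2 inc :
    N !=set0 -> argmax c N = set0 ->
    bb_step DD S c (BBRun (L1 ++ N :: L2) inc) BBException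
| BBPrune L1 N L2 inc x :
    argmax c N x -> ((dot c x)%:E <= LB c inc)%E ->
    bb_step DD S c (BBRun (L1 ++ N :: L2) inc) (BBRun (L1 ++ L2) inc)
| BBFeasible L1 N L2 inc x :
    argmax c N x -> (LB c inc < (dot c x)%:E)%E -> S x ->
    bb_step DD S c (BBRun (L1 ++ N :: L2) inc) (BBRun (L1 ++ L2) (Some x))
| BBBranch L1 N L2 inc x D :
    argmax c N x -> (LB c inc < (dot c x)%:E)%E -> ~ S x ->
    DD D -> ~ (disj_set D `&` N) x ->
    bb_step DD S c (BBRun (L1 ++ N :: L2) inc)
                   (BBRun (L1 ++ L2 ++ [seq Q `&` N | Q <- D]) inc)
| BBFail L1 N L2 inc x :
    argmax c N x -> (LB c inc < (dot c x)%:E)%E -> ~ S x ->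
    (forall D, DD D -> (disj_set D `&` N) x) ->
    bb_step DD S c (BBRun (L1 ++ N :: L2) inc) BBNoDisjunction.

(* A specific algorithm is a strategy resolving all the choices left open by
   [bb_step]: node, maximizer and disjunction. *)
Definition bb_algorithm DD S c (A : bb_state -> bb_state) : Prop :=
  forall s, if bb_final s then A s = s else bb_step DD S c s (A s).

(* Stopping criterion for the bound gamma: it holds for the incumbent and on all
   the open nodes. The work is the number of nodes created, i.e. the [k] nodes
   processed so far, one per iteration, plus the nodes still open, on which the
   criterion is evaluated. *)
Definition bb_certifies_within (A : bb_state -> bb_state) C c gamma (b : nat) :
    Prop :=
  exists k : nat,
    if iter k A (bb_init C) is BBRun L inc then
      [/\ (LB c inc <= gamma%:E)%E,
          forall N, N \in L -> N `<=` halfspace c gamma &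
          (k + size L <= b)%N]
    else False.

End EuclideanSpace.

Definition P_vertices (R : realType) (h : R) : set 'rV[R]_3 :=
  [set \row_i [:: 0; 0; 0]`_i;
       \row_i [:: 0; 2; 0]`_i;
       \row_i [:: 2; 0; 0]`_i;
       \row_i [:: 1 - h^-1; 1 - h^-1; h]`_i].

Definition P (R : realType) (h : rat) : set 'rV[R]_3 :=
  convex_hull (P_vertices (ratr h)).
Arguments P R h : clear implicits.

Definition half_cube (R : realType) (m : nat) : set 'rV[R]_m :=
  [set q : 'rV[R]_m | forall i, - 2^-1 <= q 0 i <= 2^-1].
Arguments half_cube R m : clear implicits.

Definition P_times_cube (R : realType) (h : rat) (m : nat) : set 'rV[R]_(3 + m) :=
  [set row_mx p q | p in P R h & q in half_cube R m].
Arguments P_times_cube R h m : clear implicits.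

(* Main.v *)
Require Import Defs.
From mathcomp Require Import all_boot all_order all_algebra.
From mathcomp Require Import boolp classical_sets reals constructive_ereal.
From mathcomp Require Import convex.
From mathcomp Require Import interval_inference ring lra zify.

Set Implicit Arguments.
Unset Strict Implicit.
Unset Printing Implicit Defensive.

Import Order.TTheory GRing.Theory Num.Theory.

Local Open Scope classical_set_scope.
Local Open Scope ring_scope.

(** Branch-and-bound is fast because integrality of two coordinates already
    flattens the pyramid.  If [1 < h], the apex has its first two coordinates in
    the open unit interval.  Above the base, [x1] and [x2] are positive while
    [x1 + x2 < 2]; hence each of the three pieces [x1 <= 0], [x2 <= 0] and
    [1 <= x1, 1 <= x2], which together contain all integer points, meets the
    pyramid only in its base.  Branching on [x1] and then, in the piece
    [1 <= x1], on [x2] therefore proves the bound.  If [h < 1], one branching on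
    [x3] suffices, because no point of the pyramid reaches height 1.

    Cutting planes are slow because a cut must contain the convex hull of both
    sides of a disjunction, and that hull still contains points that are nearly
    as high.  For [1 < h], follow the vertical segment below the apex (a
    [tower]).  The base vertices are integer points, so no cut ever removes them.
    If the relaxation contains the tower up to height [s], it contains the
    segments joining the tower to the base vertices; cutting with [x1 <= 0] or
    [1 <= x1] keeps the points of these segments on either side, and their hull
    covers the tower up to height [s - 2] ([cut_coord1]).  A disjunction on [x3]
    costs at most 1, and every other one costs nothing.  So after [N] cuts the
    height is at least [h - 2 * N] ([cut_tower], [relax_tower]), and the bound
    [x3 <= 0] forces [h / 2 <= N].

    Both arguments look only at three coordinates and use few facts about the
    feasible set; the predicate [pyramid] collects these facts, so that [P_h] and
    its product with a cube are treated at once. *)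

(** * Convex sets in coordinates *)
Section ConvexSets.
Context {R : realType} {n : nat}.
Local Notation V := 'rV[R]_n.
Implicit Types (A B : set V) (c x y : V).

Lemma convex_setP A :
  convex_set A <->
  forall (t : R) x y, 0 <= t <= 1 -> A x -> A y -> A (t *: x + (1 - t) *: y).
Proof.
split=> [cA t x y /andP[t0 t1] Ax Ay | cA x y t].
  by have /set_mem := cA x y (Itv01 t0 t1) (mem_set Ax) (mem_set Ay).
move=> /set_mem Ax /set_mem Ay; apply/mem_set/cA => //.
by apply/andP.
Qed.

Lemma convex_setI A B : convex_set A -> convex_set B -> convex_set (A `&` B).
Proof.
move=> /convex_setP cA /convex_setP cB; apply/convex_setP => t x y t01.
by move=> [Ax Bx] [Ay By]; split; [apply: cA | apply: cB].
Qed.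

Lemma convex_set_bigcap (I : Type) (J : set I) (F : I -> set V) :
  (forall i, J i -> convex_set (F i)) -> convex_set (\bigcap_(i in J) F i).
Proof.
move=> cF; apply/convex_setP => t x y t01 Fx Fy i Ji.
by have /convex_setP cFi := cF i Ji; apply: cFi; [|apply: Fx|apply: Fy].
Qed.

Lemma dot_delta (i : 'I_n) x : dot (delta_mx 0 i) x = x 0 i.
Proof.
rewrite /dot (bigD1 i) //= big1 => [|j /negPf ji]; rewrite mxE eqxx ?ji.
  by rewrite /= eqxx mul1r addr0.
by rewrite /= mul0r.
Qed.

Lemma dot_conv c (t u : R) x y :
  dot c (t *: x + u *: y) = t * dot c x + u * dot c y.
Proof.
rewrite /dot !mulr_sumr -big_split; apply: eq_bigr => i _.
by rewrite !mxE /=; ring.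
Qed.

Lemma convex_halfspace c (gamma : R) : convex_set (halfspace c gamma).
Proof.
apply/convex_setP => t x y /andP[t0 t1]; rewrite /halfspace /= => Hx Hy.
rewrite dot_conv; nra.
Qed.

Lemma convex_is_halfspace A : is_halfspace A -> convex_set A.
Proof. by case=> c [gamma [_ ->]]; apply: convex_halfspace. Qed.

Lemma convex_hull_convex A : convex_set (convex_hull A).
Proof. by apply: convex_set_bigcap => B []. Qed.

End ConvexSets.

(** * Variable disjunctions *)
Section VariableDisjunctions.
Context {R : realType} {n : nat}.
Local Notation V := 'rV[R]_n.

Lemma variable_disjunctionP (i : 'I_n) (K : int) (x : V) :
  Defs.disj_set (variable_disjunction i K) x <->
  x 0 i <= K%:~R \/ (K + 1)%:~R <= x 0 i.
Proof. by rewrite /Defs.disj_set /variable_disjunction !big_cons big_nil setU0. Qed.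

Lemma int_le_or_ge (a : R) (K : int) :
  a \is a Num.int -> a <= K%:~R \/ (K + 1)%:~R <= a.
Proof.
case/intrP => m ->; rewrite !ler_int; lia.
Qed.

Lemma integer_points_variable_disjunction D (x : V) :
  variable_disjunctions D -> integer_points x -> Defs.disj_set D x.
Proof. by case=> i [K ->] Sx; apply/variable_disjunctionP/int_le_or_ge. Qed.

Lemma unit_interval_or_zero (a : R) (K : int) :
  0 <= a <= 1 -> K != 0 -> a <= K%:~R \/ (K + 1)%:~R <= a.
Proof.
move=> /andP[a0 a1] K0; have [K1|K1] : (1 <= K) \/ (K + 1 <= 0) by lia.
  by left; apply: le_trans a1 _; rewrite -(ler_int R) in K1.
by right; apply: le_trans _ a0; rewrite -(ler_int R) in K1.
Qed.

End VariableDisjunctions.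

(** * Strategies for branch-and-bound *)
Section BranchAndBound.
Context {R : realType} {n : nat}.
Local Notation V := 'rV[R]_n.
Variables (DD : set (@disjunction R n)) (S : set V) (c : V).

Lemma bb_step_nonfinal s s' : bb_step DD S c s s' -> bb_final s = false.
Proof. by case=> [] [|? ?]. Qed.

Lemma bb_step_exists s : bb_final s = false -> exists s', bb_step DD S c s s'.
Proof.
case: s => [[//|N L] inc _|//|//]; rewrite -[N :: L]cat0s.
have [->|/set0P N0] := eqVneq N set0.
  by eexists; apply: BBEmpty.
have [am0|/set0P[x am]] := eqVneq (argmax c N) set0.
  by eexists; apply: BBNoMaximizer.
have [le|lt] := leP (dot c x)%:E (LB c inc).
  by eexists; apply: BBPrune am le.
have [Sx|nSx] := pselect (S x).
  by eexists; apply: BBFeasible am lt Sx.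
have [[D [DD_D Dx]]|noD] := pselect (exists D, DD D /\ ~ (Defs.disj_set D `&` N) x).
  by eexists; apply: BBBranch am lt nSx DD_D Dx.
eexists; apply: BBFail am lt nSx _ => D DD_D.
by apply: contrapT => Dx; apply: noD; exists D.
Qed.

(** An algorithm must answer in every state, also in states that a given run
    never visits.  Since each non-final state has a successor, any partial
    prescription of legal steps extends to a complete strategy; it is thus enough
    to describe the few steps of the run of interest. *)
Lemma bb_algorithm_extending (F : bb_state -> bb_state -> Prop) :
  (forall s s', F s s' -> bb_step DD S c s s') ->
  (forall s s1 s2, F s s1 -> F s s2 -> s1 = s2) ->
  exists A, bb_algorithm DD S c A /\ forall s s', F s s' -> A s = s'.
Proof.
move=> F_step F_fun.
have next s : exists s', (forall s'', F s s'' -> s' = s'') /\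
    (if bb_final s then s' = s else bb_step DD S c s s').
  have [[s' Fss']|noF] := pselect (exists s', F s s').
    exists s'; split=> [s''|]; first exact: F_fun.
    by rewrite (bb_step_nonfinal (F_step _ _ Fss')); apply: F_step.
  case: (boolP (bb_final s)) => [fin|/negbTE nfin].
    by exists s; split=> // s'' Fs; case: noF; exists s''.
  have [s' st] := bb_step_exists nfin.
  by exists s'; split=> // s'' Fs; case: noF; exists s''.
have [A hA] := choice next.
by exists A; split=> [s|s s' Fs]; [apply: (hA s).2 | apply: (hA s).1].
Qed.

End BranchAndBound.

(** * Pyramids in three of the coordinates *)
Section Pyramid.
Context {R : realType} {n : nat}.
Local Notation V := 'rV[R]_n.
Implicit Types (C G H : set V) (x : V).

Definition point3 i1 i2 i3 (a1 a2 a3 : R) : V :=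
  a1 *: delta_mx 0 i1 + a2 *: delta_mx 0 i2 + a3 *: delta_mx 0 i3.

Lemma point3_conv i1 i2 i3 (t a1 a2 a3 b1 b2 b3 : R) :
  t *: point3 i1 i2 i3 a1 a2 a3 + (1 - t) *: point3 i1 i2 i3 b1 b2 b3 =
  point3 i1 i2 i3 (t * a1 + (1 - t) * b1) (t * a2 + (1 - t) * b2)
                  (t * a3 + (1 - t) * b3).
Proof. by apply/rowP => j; rewrite !mxE; ring. Qed.

Lemma point3_swap i1 i2 i3 (a1 a2 a3 : R) :
  point3 i1 i2 i3 a1 a2 a3 = point3 i2 i1 i3 a2 a1 a3.
Proof. by congr (_ + _); rewrite addrC. Qed.

Lemma point3_coord i1 i2 i3 (a1 a2 a3 : R) j : uniq [:: i1; i2; i3] ->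
  point3 i1 i2 i3 a1 a2 a3 0 j =
  if j == i1 then a1 else if j == i2 then a2 else if j == i3 then a3 else 0.
Proof.
rewrite /= !inE negb_or andbT => /andP[/andP[n12 n13] n23]; rewrite !mxE /=.
have [->|j1] := eqVneq j i1.
  by rewrite (negPf n12) (negPf n13) mulr1 !mulr0 !addr0.
have [->|j2] := eqVneq j i2; first by rewrite (negPf n23) mulr1 !mulr0 add0r addr0.
by have [_|j3] := eqVneq j i3; rewrite !mulr0 ?mulr1 ?mulr0 !add0r.
Qed.

Lemma point3_integer i1 i2 i3 (a1 a2 a3 : R) : uniq [:: i1; i2; i3] ->
  a1 \is a Num.int -> a2 \is a Num.int -> a3 \is a Num.int ->
  integer_points (point3 i1 i2 i3 a1 a2 a3).
Proof.
by move=> u ? ? ? j; rewrite point3_coord //; do 3 case: ifP => // _; apply: rpred0.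
Qed.

Lemma convex_point3 C i1 i2 i3 (t a1 a2 a3 b1 b2 b3 c1 c2 c3 : R) :
  convex_set C -> 0 <= t <= 1 ->
  C (point3 i1 i2 i3 a1 a2 a3) -> C (point3 i1 i2 i3 b1 b2 b3) ->
  c1 = t * a1 + (1 - t) * b1 -> c2 = t * a2 + (1 - t) * b2 ->
  c3 = t * a3 + (1 - t) * b3 ->
  C (point3 i1 i2 i3 c1 c2 c3).
Proof.
move=> /convex_setP cC t01 Ca Cb -> -> ->; rewrite -point3_conv.
exact: cC.
Qed.

(** The part of the geometry of [P_h] used below.  The facets are multiplied by
    [h ^+ 2] to avoid divisions: they are [0 <= x3], the two facets through the
    apex and the base edges on the axes, where [x1] and [x2] go from 0 to
    [1 - h^-1], and the facet through the apex and the base edge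
    [x1 + x2 = 2]. *)
Record pyramid (h : R) C i1 i2 i3 : Prop := Pyramid {
  pyr_uniq : uniq [:: i1; i2; i3];
  pyr_convex : convex_set C;
  pyr_origin : C (point3 i1 i2 i3 0 0 0);
  pyr_base1 : C (point3 i1 i2 i3 2 0 0);
  pyr_base2 : C (point3 i1 i2 i3 0 2 0);
  pyr_apex : C (point3 i1 i2 i3 (1 - h^-1) (1 - h^-1) h);
  pyr_facets : forall x, C x ->
    [/\ 0 <= x 0 i3, (h - 1) * x 0 i3 <= h ^+ 2 * x 0 i1,
        (h - 1) * x 0 i3 <= h ^+ 2 * x 0 i2 &
        h ^+ 2 * (x 0 i1 + x 0 i2) + 2 * x 0 i3 <= h ^+ 2 * 2] }.

(** * Optimal value and branch-and-bound certificate *)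
Section UpperBound.
Variables (h : R) (C : set V) (i1 i2 i3 : 'I_n).
Hypotheses (h0 : 0 < h) (pC : pyramid h C i1 i2 i3).

Let h2_gt0 : 0 < h ^+ 2. Proof. exact: exprn_gt0. Qed.

Lemma pyramid_coords a1 a2 a3 :
  [/\ point3 i1 i2 i3 a1 a2 a3 0 i1 = a1, point3 i1 i2 i3 a1 a2 a3 0 i2 = a2 &
      point3 i1 i2 i3 a1 a2 a3 0 i3 = a3].
Proof.
have u := pyr_uniq pC; rewrite !point3_coord //.
move: u; rewrite /= !inE negb_or andbT => /andP[/andP[n12 n13] n23].
by rewrite !eqxx (eq_sym i2) (negPf n12) !(eq_sym i3) (negPf n13) (negPf n23).
Qed.

(** The sum of the three slanted facet inequalities eliminates [x1] and [x2]. *)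
Lemma pyramid_height x : C x -> x 0 i3 <= h.
Proof.
move=> /(pyr_facets pC)[x3 f1 f2 f3].
have : h * x 0 i3 <= h * h by nra.
by rewrite ler_pM2l.
Qed.

Lemma pyramid_le0_coord1 x : 1 < h -> C x -> x 0 i1 <= 0 -> x 0 i3 <= 0.
Proof.
move=> h1 /(pyr_facets pC)[x3 f1 f2 f3] x1.
have : (h - 1) * x 0 i3 <= (h - 1) * 0 by nra.
by rewrite ler_pM2l // subr_gt0.
Qed.

Lemma pyramid_le0_coord2 x : 1 < h -> C x -> x 0 i2 <= 0 -> x 0 i3 <= 0.
Proof.
move=> h1 /(pyr_facets pC)[x3 f1 f2 f3] x1.
have : (h - 1) * x 0 i3 <= (h - 1) * 0 by nra.
by rewrite ler_pM2l // subr_gt0.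
Qed.

Lemma pyramid_ge1_coord12 x : C x -> 1 <= x 0 i1 -> 1 <= x 0 i2 -> x 0 i3 <= 0.
Proof. move=> /(pyr_facets pC)[x3 f1 f2 f3] x1 x2; nra. Qed.

(** Integer points satisfy the same disjunctions that the branch-and-bound run
    uses, so the bounds on its leaves give the optimal value. *)
Lemma pyramid_integer_le0 x : h != 1 -> C x -> integer_points x -> x 0 i3 <= 0.
Proof.
move=> hn1 Cx Sx; have [h1|h1|/eqP] := ltgtP h 1; last by rewrite (negPf hn1).
  have [//|] := int_le_or_ge 0 (Sx i3); have := pyramid_height Cx.
  by rewrite add0r; lra.
have [/(pyramid_le0_coord1 h1 Cx)//|x1] := int_le_or_ge 0 (Sx i1).
have [/(pyramid_le0_coord2 h1 Cx)//|x2] := int_le_or_ge 0 (Sx i2).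
exact: pyramid_ge1_coord12.
Qed.

Lemma pyramid_optimal_value :
  h != 1 -> optimal_value (delta_mx 0 i3) (C `&` integer_points) 0.
Proof.
move=> hn1; split; last first.
  by move=> x [Cx Sx]; rewrite dot_delta pyramid_integer_le0.
exists (point3 i1 i2 i3 0 0 0); last first.
  by have [_ _ a3] := pyramid_coords 0 0 0; rewrite dot_delta a3.
split; first exact: pyr_origin pC.
by apply: point3_integer (pyr_uniq pC) _ _ _; apply: rpred0.
Qed.

Local Notation step :=
  (bb_step variable_disjunctions integer_points (delta_mx 0 i3)).

(** The disjunction misses the maximizer when [x 0 i] lies strictly between [K]
    and [K + 1], which also excludes that the maximizer is an integer point. *)
Lemma bb_branch_variable L1 N L2 x i K :
  N x -> (forall y, N y -> y 0 i3 <= x 0 i3) ->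
  K%:~R < x 0 i < (K + 1)%:~R ->
  step (BBRun (L1 ++ N :: L2) None)
       (BBRun (L1 ++ L2 ++ [seq Q `&` N | Q <- variable_disjunction i K]) None).
Proof.
move=> Nx mx /andP[lo up].
have DD : variable_disjunctions (@variable_disjunction R n i K).
  by exists i, K.
have nD : ~ Defs.disj_set (variable_disjunction i K) x.
  by move/variable_disjunctionP; case; rewrite leNgt ?lo ?up.
apply: (@BBBranch _ _ _ _ _ _ _ _ _ x) => //.
- by split=> // y Ny; rewrite !dot_delta mx.
- by rewrite /= ltNye.
- by move=> Sx; apply: nD; apply: integer_points_variable_disjunction.
- by case=> /nD.
Qed.

Let c := (delta_mx 0 i3 : V).
Let s0 := bb_init C.

(** The node [1 <= x3] is empty, so branching once at the apex suffices.  The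
    budget 5 is the one needed for tall pyramids. *)
Lemma pyramid_certificate_short : h < 1 ->
  exists A, bb_algorithm variable_disjunctions integer_points c A /\
            bb_certifies_within A C c 0 5.
Proof.
move=> h1; pose s1 := BBRun [seq Q `&` C | Q <- variable_disjunction i3 0] None.
have [||A [algA runA]] := @bb_algorithm_extending _ _ variable_disjunctions
  integer_points c (fun s s' => s = s0 /\ s' = s1).
- move=> _ _ [-> ->].
  have [_ _ a3] := pyramid_coords (1 - h^-1) (1 - h^-1) h.
  apply: (@bb_branch_variable [::] C [::] _ i3 0 (pyr_apex pC)); rewrite a3.
    exact: pyramid_height.
  by rewrite h0 add0r.
- by move=> s s' s'' [_ ->] [_ ->].
exists A; split=> //; exists 1%N; rewrite /= (runA _ s1) //=.
split=> //; first exact: leNye.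
move=> N; rewrite !inE => /orP[] /eqP-> x [/= Qx Cx];
  rewrite /halfspace /= dot_delta //.
by have := pyramid_height Cx; rewrite add0r in Qx; lra.
Qed.

(** Two branchings produce three open nodes, all of which lie in [x3 <= 0]. *)
Lemma pyramid_certificate_tall : 1 < h ->
  exists A, bb_algorithm variable_disjunctions integer_points c A /\
            bb_certifies_within A C c 0 5.
Proof.
move=> h1.
have ih : 0 < h^-1 < 1 by rewrite invr_gt0 h0 invf_lt1.
pose Q1 := [set x : V | x 0 i1 <= 0%:~R].
pose N := [set x : V | (0 + 1)%:~R <= x 0 i1] `&` C.
pose s1 := BBRun [:: Q1 `&` C; N] None.
pose s2 := BBRun ([:: Q1 `&` C] ++
  [seq Q `&` N | Q <- variable_disjunction i2 0]) None.
have s01 : step s0 s1.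
  have [a1 _ a3] := pyramid_coords (1 - h^-1) (1 - h^-1) h.
  apply: (@bb_branch_variable [::] C [::] _ i1 0 (pyr_apex pC)).
    by rewrite a3; exact: pyramid_height.
  by rewrite a1 add0r; lra.
have s12 : step s1 s2.
  (* The highest point with [1 <= x1]: the edge from the apex to the base vertex
     (2, 0, 0) crosses the plane [x1 = 1] there. *)
  pose y := point3 i1 i2 i3 1 ((h - 1) / (h + 1)) (h ^+ 2 / (h + 1)).
  have [y1 y2 y3] : [/\ y 0 i1 = 1, y 0 i2 = (h - 1) / (h + 1) &
      y 0 i3 = h ^+ 2 / (h + 1)] by exact: pyramid_coords.
  apply: (@bb_branch_variable [:: _] N [::] y i2 0).
  - split; first by rewrite /= y1 add0r.
    apply: (@convex_point3 _ _ _ _ (h / (h + 1)) _ _ _ _ _ _ _ _ _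
      (pyr_convex pC) _ (pyr_apex pC) (pyr_base1 pC)).
    + rewrite divr_ge0 ?ler_pdivrMr; lra.
    + by field; lra.
    + by field; lra.
    + by field; lra.
  - move=> z [/= z1 Cz]; rewrite add0r in z1.
    have [z3 f1 f2 f3] := pyr_facets pC Cz; rewrite y3 ler_pdivlMr; nra.
  - rewrite y2 add0r ltr_pdivrMr ?divr_gt0; lra.
have [||A [algA runA]] := @bb_algorithm_extending _ _ variable_disjunctions
  integer_points c (fun s s' => (s = s0 /\ s' = s1) \/ (s = s1 /\ s' = s2)).
- by move=> _ _ [[-> ->]|[-> ->]].
- by move=> s s' s'' [[-> ->]|[-> ->]] [[// ->]|[// ->]].
exists A; split=> //; exists 2%N; rewrite /= (runA s0 s1); last by left.
rewrite (runA s1 s2) /=; last by right.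
split; [exact: leNye | move=> M | by []].
rewrite !inE => /or3P[] /eqP-> x; rewrite /halfspace /= dot_delta.
- by move=> [x1 Cx]; exact: pyramid_le0_coord1.
- by move=> [x2 [_ Cx]]; exact: pyramid_le0_coord2.
- by move=> [/= x2 [/= x1 Cx]]; rewrite add0r in x1 x2; exact: pyramid_ge1_coord12.
Qed.

End UpperBound.

(** * Length of cutting plane proofs *)
Section LowerBound.
Variables (h : R) (C : set V) (i1 i2 i3 : 'I_n).
(** The factor [(h + 1) / (h - 1)] comes from two convex combinations.  The
    segment from height [t'] on the tower to the base vertex (2, 0, 0) meets
    [x1 = 1] at height [t' * h / (h + 1)].  Joining that point to the base edge
    [x1 = 0] returns to [x1 = 1 - h^-1] with the further factor [1 - h^-1], so
    the resulting height is [t' * (h - 1) / (h + 1)].  The endpoints lie on the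
    two sides of the disjunction, hence in the cut. *)
Lemma cut_coord1 G H j1 j2 j3 (K : int) (t : R) :
  1 < h -> uniq [:: j1; j2; j3] -> convex_set G -> convex_set H ->
  G `&` Defs.disj_set (variable_disjunction j1 K) `<=` H ->
  G (point3 j1 j2 j3 0 0 0) -> G (point3 j1 j2 j3 2 0 0) ->
  G (point3 j1 j2 j3 0 2 0) -> 0 <= t ->
  G (point3 j1 j2 j3 (1 - h^-1) (1 - h^-1) t) ->
  G (point3 j1 j2 j3 (1 - h^-1) (1 - h^-1) (t * (h + 1) / (h - 1))) ->
  H (point3 j1 j2 j3 (1 - h^-1) (1 - h^-1) t).
Proof.
move=> h1 u cG cH GDH G0 G1 G2 t0 Gt Gt'.
have h0 : 0 < h by lra.
have ih : 0 < h^-1 < 1 by rewrite invr_gt0 h0 invf_lt1.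
have [K0|K0] := eqVneq K 0; last first.
  apply: GDH; split=> //; apply/variable_disjunctionP.
  by rewrite point3_coord // eqxx; apply: unit_interval_or_zero => //; lra.
rewrite {}K0 in GDH.
(* The point on the base edge is chosen so that the combination has
   [x2 = 1 - h^-1]. *)
apply: (@convex_point3 _ _ _ _ (1 - h^-1) 1 ((h - 1) / (h + 1)) (t * h / (h - 1))
  0 (2 * (h - 1) / (h + 1)) 0) => //; first lra.
- apply: GDH; split; last first.
    by apply/variable_disjunctionP; right; rewrite point3_coord // eqxx add0r.
  apply: (@convex_point3 _ _ _ _ (h / (h + 1)) _ _ _ _ _ _ _ _ _ cG _ Gt' G1).
  + rewrite divr_ge0 ?ler_pdivrMr; lra.
  + by field; lra.
  + by field; lra.
  + by field; apply/andP; split; lra.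
- apply: GDH; split; last first.
    by apply/variable_disjunctionP; left; rewrite point3_coord // eqxx.
  apply: (@convex_point3 _ _ _ _ ((h - 1) / (h + 1)) _ _ _ _ _ _ _ _ _ cG _ G2 G0).
  + rewrite divr_ge0 ?ler_pdivrMr; lra.
  + by field; lra.
  + by field; lra.
  + by field; lra.
- by field; lra.
- by field; apply/andP; split; lra.
- by field; apply/andP; split; lra.
Qed.

(** The points up to height [s] on the vertical line through the apex. *)
Definition tower G (s : R) : Prop :=
  forall t, 0 <= t <= s -> G (point3 i1 i2 i3 (1 - h^-1) (1 - h^-1) t).

Definition on_base G : Prop :=
  [/\ G (point3 i1 i2 i3 0 0 0), G (point3 i1 i2 i3 2 0 0) &
      G (point3 i1 i2 i3 0 2 0)].

Lemma cut_on_base G H D :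
  uniq [:: i1; i2; i3] -> variable_disjunctions D -> cutting_plane G D H ->
  on_base G -> on_base H.
Proof.
move=> u DD [_ GDH] [G0 G1 G2].
have keep a b : a \is a Num.int -> b \is a Num.int ->
    G (point3 i1 i2 i3 a b 0) -> H (point3 i1 i2 i3 a b 0).
  move=> ai bi Gab; apply: GDH; split=> //.
  apply: integer_points_variable_disjunction => //.
  by apply: point3_integer u _ _ _ => //; apply: rpred0.
by split; apply: keep => //; rewrite ?rpred0 ?rpred_nat.
Qed.

(** Heights [t <= s - 2] have to survive, and since [s <= h] the height that
    [cut_coord1] asks for exceeds such a [t] by [2 * t / (h - 1)], less than 2.
    For a disjunction on the height, the two neighbouring integer heights survive
    and recover every point between them. *)
Lemma cut_tower G H D (s : R) :
  1 < h -> uniq [:: i1; i2; i3] ->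
  variable_disjunctions D -> cutting_plane G D H -> convex_set G ->
  on_base G -> s <= h -> tower G s -> tower H (s - 2).
Proof.
move=> h1 u [i [K ->]] [/convex_is_halfspace cH GDH] cG.
move=> [G0 G1 G2] sh Gs t /andP[t0 ts].
have u' : uniq [:: i2; i1; i3].
  rewrite -(perm_uniq (s1 := [:: i1; i2; i3])) //.
  exact/permPl/(perm_catCA [:: i1] [:: i2] [:: i3]).
have Gt : G (point3 i1 i2 i3 (1 - h^-1) (1 - h^-1) t) by apply: Gs; lra.
have Gt' : G (point3 i1 i2 i3 (1 - h^-1) (1 - h^-1) (t * (h + 1) / (h - 1))).
  apply: Gs; rewrite divr_ge0 ?mulr_ge0 ?ler_pdivrMr; try lra.
  nra.
have [i_1|n1] := eqVneq i i1.
  by rewrite {}i_1 in GDH; apply: cut_coord1 h1 _ _ _ GDH _ _ _ _ _ _.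
have [i_2|n2] := eqVneq i i2.
  rewrite {}i_2 in GDH; rewrite point3_swap.
  apply: cut_coord1 h1 _ _ _ GDH _ _ _ _ _ _ => //;
  by rewrite point3_swap.
have in_D a : 0 <= a <= s -> a <= K%:~R \/ (K + 1)%:~R <= a ->
    H (point3 i1 i2 i3 (1 - h^-1) (1 - h^-1) a).
  move=> a_s aK; apply: GDH; split; first exact: Gs.
  apply/variable_disjunctionP; rewrite point3_coord // (negPf n1) (negPf n2).
  by case: ifP => // _; apply: int_le_or_ge; apply: rpred0.
have [tK|Kt] := leP t K%:~R; first by apply: in_D; [lra | by left].
have [tK1|tK1] := leP (K + 1)%:~R t; first by apply: in_D; [lra | right].
have K0 : 0 <= (K%:~R : R).
  rewrite ler0z; have : (0 : R) < (K + 1)%:~R by lra.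
  by rewrite ltr0z; lia.
have K1E : (K + 1)%:~R = K%:~R + 1 :> R by rewrite rmorphD.
rewrite K1E in tK1.
apply: (@convex_point3 _ _ _ _ (t - K%:~R) _ _ (K%:~R + 1) _ _ K%:~R _ _ _ cH).
- lra.
- by apply: in_D; [lra | right; rewrite K1E].
- by apply: in_D; [lra | by left].
- ring.
- ring.
- ring.
Qed.

Lemma pyramid_tower : 1 < h -> pyramid h C i1 i2 i3 -> tower C h.
Proof.
move=> h1 pC t /andP[t0 th].
have h0 : 0 < h by lra.
have ih : 0 < h^-1 < 1 by rewrite invr_gt0 h0 invf_lt1.
have [cC C0 C1 C2] : [/\ convex_set C, C (point3 i1 i2 i3 0 0 0),
    C (point3 i1 i2 i3 2 0 0) & C (point3 i1 i2 i3 0 2 0)] by case: pC.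
have C11 : C (point3 i1 i2 i3 1 1 0).
  by apply: (@convex_point3 _ _ _ _ 2^-1 _ _ _ _ _ _ _ _ _ cC _ C1 C2);
     lra.
have Cfoot : C (point3 i1 i2 i3 (1 - h^-1) (1 - h^-1) 0).
  by apply: (@convex_point3 _ _ _ _ (1 - h^-1) _ _ _ _ _ _ _ _ _ cC _ C11 C0); lra.
apply: (@convex_point3 _ _ _ _ (t / h) _ _ _ _ _ _ _ _ _ cC _ (pyr_apex pC) Cfoot).
- rewrite divr_ge0 ?ler_pdivrMr; lra.
- ring.
- ring.
- by field; lra.
Qed.

Lemma relax_tower (Hs : seq (set V)) (Ds : seq disjunction) i :
  1 < h -> pyramid h C i1 i2 i3 ->
  let relax i := C `&` \bigcap_(j < i) nth setT Hs j in
  (forall i, (i < size Hs)%N -> variable_disjunctions (nth [::] Ds i) /\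
     cutting_plane (relax i) (nth [::] Ds i) (nth setT Hs i)) ->
  (i <= size Hs)%N ->
  [/\ convex_set (relax i), on_base (relax i) & tower (relax i) (h - 2 * i%:R)].
Proof.
move=> h1 pC relax cuts; have u := pyr_uniq pC; elim: i => [|i IH] iN.
  have -> : relax 0%N = C by apply/seteqP; split=> [x []|x Cx] //; split.
  split; [exact: pyr_convex pC | by case: pC |].
  by rewrite mulr0 subr0; exact: pyramid_tower.
have [cG bG tG] := IH (ltnW iN); have [DD cut] := cuts i iN.
have relaxS : relax i.+1 = relax i `&` nth setT Hs i.
  apply/seteqP; split=> x [].
    move=> Cx Hx; split; last by apply: Hx => /=.
    by split=> // j /= ji; apply: Hx => /=; apply: ltnW.
  move=> [Cx Hx] Hi; split=> // j /=; rewrite ltnS leq_eqVlt => /predU1P[-> //|ji].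
  exact: Hx.
have [b0 b1 b2] := bG; have [b0' b1' b2'] := cut_on_base u DD cut bG.
rewrite relaxS; split=> //.
  by apply: convex_setI => //; apply: convex_is_halfspace; case: cut.
have sh : h - 2 * i%:R <= h by rewrite lerBlDr lerDl mulr_ge0.
have tH := cut_tower h1 u DD cut cG bG sh tG.
have E : h - 2 * i.+1%:R = h - 2 * i%:R - 2 by rewrite -natr1; ring.
rewrite E => t t01; split; last exact: tH.
by apply: tG; lra.
Qed.

End LowerBound.

(** When [h <= 1], the claim only says that the empty proof fails, because the
    apex violates the bound. *)
Lemma pyramid_cutting_plane_length h C i1 i2 i3 (Hs : seq (set V)) :
  0 < h -> pyramid h C i1 i2 i3 ->
  cutting_plane_proof variable_disjunctions C integer_points
    (delta_mx 0 i3) 0 Hs ->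
  h / 2 <= (size Hs)%:R.
Proof.
move=> h0 pC [_ [Ds [_ cuts]] fin].
have coords := pyramid_coords pC.
have [h1|h1] := lerP h 1.
  case: Hs {cuts} fin => [|H Hs] fin; last first.
    by have := ler1n R (size (H :: Hs)); rewrite /= ltn0Sn; lra.
  have [_ _ a3] := coords (1 - h^-1) (1 - h^-1) h.
  have := fin (point3 i1 i2 i3 (1 - h^-1) (1 - h^-1) h); rewrite /halfspace /=.
  rewrite dot_delta a3.
  suff /[swap]/[apply] : (C `&` \bigcap_(j < 0) nth setT [::] j)
     (point3 i1 i2 i3 (1 - h^-1) (1 - h^-1) h) by lra.
  by split; first exact: pyr_apex pC.
have [_ _ top] := relax_tower h1 pC cuts (leqnn _).
have [//|lt] := leP (h / 2) (size Hs)%:R.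
set t := h - 2 * (size Hs)%:R in top.
have t0 : 0 < t by rewrite /t; lra.
have [_ _ a3] := coords (1 - h^-1) (1 - h^-1) t.
have := fin _ (top t _); rewrite /halfspace /= dot_delta a3; lra.
Qed.

End Pyramid.

(** * The pyramid [P_h] and its product with a cube *)
Section Instances.
Context {R : realType}.

Lemma P_pyramid (h : rat) : 0 < h ->
  pyramid (ratr h : R) (P R h) ord0 (lift ord0 ord0) ord_max.
Proof.
rewrite -(ltr0q R) => h0; set k : R := ratr h in h0 *.
have vertexE (a1 a2 a3 : R) : point3 ord0 (lift ord0 ord0) ord_max a1 a2 a3 =
    \row_(i < 3) [:: a1; a2; a3]`_i.
  apply/rowP => -[[|[|[|//]]] i3]; rewrite !mxE /=; ring.
have vertices : P_vertices k `<=` P R h by apply: sub_gen_smallest.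
split=> //; rewrite ?vertexE.
- exact: convex_hull_convex.
- by apply: vertices; left; left; left.
- by apply: vertices; left; right.
- by apply: vertices; left; left; right.
- by apply: vertices; right.
apply: smallest_sub.
  apply/convex_setP => t x y /andP[t0 t1] [x0 x1 x2 x3] [y0 y1 y2 y3].
  by split; rewrite !mxE; nra.
have k2 : 0 < k ^+ 2 by apply: exprn_gt0.
have kV : k * k^-1 = 1 by rewrite divff ?gt_eqF.
move=> x [[[]|]|] ->; rewrite !mxE /=; split; nra.
Qed.

Lemma row_mx_point3 n m (i1 i2 i3 : 'I_n) (a1 a2 a3 : R) :
  row_mx (point3 i1 i2 i3 a1 a2 a3) 0 =
  point3 (lshift m i1) (lshift m i2) (lshift m i3) a1 a2 a3.
Proof.
apply/rowP => j; case: (split_ordP j) => k ->.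
  by rewrite row_mxEl !mxE !eq_lshift.
by rewrite row_mxEr !mxE !eq_rlshift !mulr0 !addr0.
Qed.

Lemma pyramid_times_cube n m (h : R) (C : set 'rV[R]_n) i1 i2 i3 :
  pyramid h C i1 i2 i3 ->
  pyramid h [set row_mx p q | p in C & q in half_cube R m]
    (lshift m i1) (lshift m i2) (lshift m i3).
Proof.
case=> u cC C0 C1 C2 Ch facets.
have cube0 : half_cube R m 0 by move=> i; rewrite mxE; lra.
have slice a1 a2 a3 : C (point3 i1 i2 i3 a1 a2 a3) ->
    [set row_mx p q | p in C & q in half_cube R m]
      (point3 (lshift m i1) (lshift m i2) (lshift m i3) a1 a2 a3).
  by move=> Ca; rewrite -row_mx_point3;
     exists (point3 i1 i2 i3 a1 a2 a3) => //; exists 0.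
split; try exact: slice.
- by have := u; rewrite -(map_inj_uniq (@lshift_inj n m)).
- have {}cC := (convex_setP C).1 cC; apply/convex_setP => t x y t01.
  move=> [p Cp [q Qq <-]] [p' Cp' [q' Qq' <-]].
  rewrite !scale_row_mx add_row_mx; exists (t *: p + (1 - t) *: p').
    exact: cC.
  exists (t *: q + (1 - t) *: q') => // i; rewrite !mxE.
  have /andP[t0 t1] := t01.
  by have /andP[? ?] := Qq i; have /andP[? ?] := Qq' i; nra.
- by move=> _ [p Cp [q _ <-]]; rewrite !row_mxEl; apply: facets.
Qed.

End Instances.

Theorem theorem2p9 (R : realType) :
  exists (b : nat) (alpha : R), 0 < alpha /\
    forall h : rat, 0 < h ->
      let claim (n : nat) (C : set 'rV[R]_n) (i3 : 'I_n) : Prop :=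
        let S := @integer_points R n in
        let DD := @variable_disjunctions R n in
        let c : 'rV[R]_n := delta_mx 0 i3 in
        (h != 1 ->
           optimal_value c (C `&` S) 0 /\
           exists A, bb_algorithm DD S c A /\ bb_certifies_within A C c 0 b) /\
        (forall Hs : seq (set 'rV[R]_n),
           cutting_plane_proof DD C S c 0 Hs ->
           alpha * ratr h <= (size Hs)%:R) in
      claim 3%N (P R h) ord_max /\
      (forall m : nat,
         claim (3 + m)%N (P_times_cube R h m) (lshift m ord_max)).
Proof.
exists 5%N, 2^-1; split=> [|h h_gt0 claim]; first by rewrite invr_gt0.
have h0 : 0 < ratr h :> R by rewrite ltr0q.
have pyramid_claim n (C : set 'rV[R]_n) i1 i2 i3 :
    pyramid (ratr h) C i1 i2 i3 -> claim n C i3.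
  move=> pC; split=> [h1|Hs pf]; last first.
    by rewrite mulrC; apply: pyramid_cutting_plane_length h0 pC pf.
  have {}h1 : ratr h != 1 :> R by rewrite fmorph_eq1.
  split; first exact: pyramid_optimal_value h0 pC h1.
  have [lt|lt|/eqP] := ltgtP (ratr h : R) 1; last by rewrite (negPf h1).
    exact: pyramid_certificate_short pC lt.
  exact: pyramid_certificate_tall pC lt.
have pP := @P_pyramid R h h_gt0.
split=> [|m]; first exact: pyramid_claim pP.
exact: pyramid_claim (pyramid_times_cube m pP).
Qed.
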